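(* Let $\mathbf{x}\in\mathbb{R}^{N}$ be approximately $K$-sparse, and let $\mathbf{y}=\mathbf{\Phi}\mathbf{x}+\mathbf{e}\in\mathbb{R}^m$ with $\mathbf{e}\in\mathbb{R}^m$. Suppose that the sampling matrix $\mathbf{\Phi}\in\mathbb{R}^{m\times N}$ satisfies the RIP with parameter $\delta_{6K}<0.083$. Then the output $\hat{\mathbf{x}}$ of the subspace pursuit (SP) algorithm run with input sparsity level $2K$, i.e. with input $(2K,\mathbf{\Phi},\mathbf{y})$, satisfies $$\|\mathbf{x}-\hat{\mathbf{x}}\|_2\le c_{2K}'\left(\|\mathbf{e}\|_2+\sqrt{\frac{1+\delta_{6K}}{K}}\,\|\mathbf{x}-\mathbf{x}_K\|_1\right),\qquad c_{2K}'=\frac{1+\delta_{6K}+\delta_{6K}^2}{\delta_{6K}(1-\delta_{6K})}.$$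
   Context: Notation: $\mathbf{x}_K$ denotes the vector obtained from $\mathbf{x}$ by keeping the $K$ entries of largest magnitude and setting all other entries to zero; $\mathbf{x}$ is approximately $K$-sparse if $\mathbf{x}-\mathbf{x}_K\neq\mathbf{0}$. For an index set $I\subset\{1,\dots,N\}$, $\mathbf{\Phi}_I$ is the submatrix of columns of $\mathbf{\Phi}$ indexed by $I$ and, for a vector $\mathbf{z}$, $\mathbf{z}_I$ is the vector of entries of $\mathbf{z}$ indexed by $I$. $^*$ denotes transposition. When $\mathbf{\Phi}_I^*\mathbf{\Phi}_I$ is invertible, $\mathbf{\Phi}_I^{\dagger}:=(\mathbf{\Phi}_I^*\mathbf{\Phi}_I)^{-1}\mathbf{\Phi}_I^*$, $\mathrm{proj}(\mathbf{y},\mathbf{\Phi}_I):=\mathbf{\Phi}_I\mathbf{\Phi}_I^{\dagger}\mathbf{y}$ and $\mathrm{resid}(\mathbf{y},\mathbf{\Phi}_I):=\mathbf{y}-\mathrm{proj}(\mathbf{y},\mathbf{\Phi}_I)$. RIP: for $k\le m$ and $0\le\delta\le1$, $\mathbf{\Phi}$ satisfies the RIP with parameters $(k,\delta)$ if $(1-\delta)\|\mathbf{q}\|_2^2\le\|\mathbf{\Phi}_I\mathbf{q}\|_2^2\le(1+\delta)\|\mathbf{q}\|_2^2$ for all $I\subset\{1,\dots,N\}$ with $|I|\le k$ and all $\mathbf{q}\in\mathbb{R}^{|I|}$. The RIP constant $\delta_k$ is the infimum of all such $\delta$. SP algorithm with input $(k,\mathbf{\Phi},\mathbf{y})$ (used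 in the claim with $k=2K$). Initialization: $T^0$ is the set of $k$ indices of the largest-magnitude entries of $\mathbf{\Phi}^*\mathbf{y}$, and $\mathbf{y}_r^0=\mathrm{resid}(\mathbf{y},\mathbf{\Phi}_{T^0})$. Iteration $\ell=1,2,\dots$: (1) $\tilde T^{\ell}=T^{\ell-1}\cup\{k$ indices of the largest-magnitude entries of $\mathbf{\Phi}^*\mathbf{y}_r^{\ell-1}\}$; (2) $\mathbf{x}_p=\mathbf{\Phi}_{\tilde T^{\ell}}^{\dagger}\mathbf{y}$ (a vector indexed by $\tilde T^{\ell}$); (3) $T^{\ell}$ is the set of the $k$ indices in $\tilde T^{\ell}$ of the largest-magnitude entries of $\mathbf{x}_p$; (4) $\mathbf{y}_r^{\ell}=\mathrm{resid}(\mathbf{y},\mathbf{\Phi}_{T^{\ell}})$; (5) if $\|\mathbf{y}_r^{\ell}\|_2>\|\mathbf{y}_r^{\ell-1}\|_2$, set $T^{\ell}=T^{\ell-1}$ and quit the iteration. Ties are broken arbitrarily. Output (upon quitting): $\hat{\mathbf{x}}$ with $\hat{\mathbf{x}}_{\{1,\dots,N\}-T^{\ell}}=\mathbf{0}$ and $\hat{\mathbf{x}}_{T^{\ell}}=\mathbf{\Phi}_{T^{\ell}}^{\dagger}\mathbf{y}$. *)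

(* Defs.v *)
From mathcomp Require Import all_boot all_order all_algebra.
From mathcomp Require Import classical_sets reals.

Set Implicit Arguments.
Unset Strict Implicit.
Unset Printing Implicit Defensive.

Import Order.TTheory GRing.Theory Num.Theory.
Local Open Scope ring_scope.

Definition norm1 (R : realType) (n : nat) (z : 'cV[R]_n) : R :=
  \sum_(i < n) `|z i 0|.

(* The norm `|z| on matrices in MathComp-Analysis is the sup norm, hence this
   definition of the Euclidean norm. *)
Definition norm2 (R : realType) (n : nat) (z : 'cV[R]_n) : R :=
  Num.sqrt (\sum_(i < n) z i 0 ^+ 2).

Definition cols (R : realType) (m N : nat) (I : {set 'I_N})
    (Phi : 'M[R]_(m, N)) : 'M[R]_(m, #|I|) :=
  colsub (fun j : 'I_#|I| => enum_val j) Phi.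

Definition entries (R : realType) (N : nat) (I : {set 'I_N})
    (z : 'cV[R]_N) : 'cV[R]_#|I| :=
  rowsub (fun j : 'I_#|I| => enum_val j) z.

(* Only meaningful when A^T *m A is invertible. *)
Definition pinv (R : realType) (m n : nat) (A : 'M[R]_(m, n)) : 'M[R]_(n, m) :=
  invmx (A^T *m A) *m A^T.

Definition proj (R : realType) (m n : nat) (y : 'cV[R]_m) (A : 'M[R]_(m, n)) :
  'cV[R]_m := A *m (pinv A *m y).

Definition resid (R : realType) (m n : nat) (y : 'cV[R]_m) (A : 'M[R]_(m, n)) :
  'cV[R]_m := y - proj y A.

Definition RIP (R : realType) (m N : nat) (Phi : 'M[R]_(m, N)) (k : nat)
    (delta : R) : Prop :=
  [/\ (k <= m)%N, 0 <= delta <= 1 &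
    forall (I : {set 'I_N}) (q : 'cV[R]_#|I|), (#|I| <= k)%N ->
      (1 - delta) * norm2 q ^+ 2 <= norm2 (cols I Phi *m q) ^+ 2
        <= (1 + delta) * norm2 q ^+ 2].

(* Pitfall: inf is 0 on the empty set, so a bound on RIP_const carries
   information only together with RIP Phi k (RIP_const Phi k), i.e. when some
   delta is admissible (the infimum is then attained). *)
Definition RIP_const (R : realType) (m N : nat) (Phi : 'M[R]_(m, N)) (k : nat) :
  R := inf [set delta : R | RIP Phi k delta]%classic.

(* S is a possible set of k indices of largest-magnitude entries of z; being a
   relation, it allows every way of breaking ties. *)
Definition top_indices (R : realType) (n k : nat) (z : 'cV[R]_n)
    (S : {set 'I_n}) : Prop :=
  #|S| = k /\ forall i j : 'I_n, i \in S -> j \notin S -> `|z j 0| <= `|z i 0|.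

(* xK is a version of x_K; x - x_K depends on how ties are broken, but its
   norms do not. *)
Definition best_approx (R : realType) (N K : nat) (x xK : 'cV[R]_N) : Prop :=
  exists2 S : {set 'I_N}, top_indices K x S &
    xK = \col_(i < N) (if i \in S then x i 0 else 0).

(* From the current set T to the next candidate set T'. The current residual is
   a function of T, so T is the whole state of the algorithm. The vector x_p is
   indexed by 'I_#|Tt|; enum_val translates its indices back to 'I_N. *)
Definition SP_step (R : realType) (m N : nat) (k : nat) (Phi : 'M[R]_(m, N))
    (y : 'cV[R]_m) (T T' : {set 'I_N}) : Prop :=
  exists2 S : {set 'I_N}, top_indices k (Phi^T *m resid y (cols T Phi)) S &
    let Tt := T :|: S in
    let xp := pinv (cols Tt Phi) *m y in
    exists2 J : {set 'I_#|Tt|}, top_indices k xp J &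
      T' = [set enum_val j | j in J].

(* SP_reach k Phi y T: some execution has T as its current set T^l after
   l >= 0 iterations, none of which has quit. *)
Inductive SP_reach (R : realType) (m N : nat) (k : nat) (Phi : 'M[R]_(m, N))
    (y : 'cV[R]_m) : {set 'I_N} -> Prop :=
| SP_reach_init (T : {set 'I_N}) :
    top_indices k (Phi^T *m y) T -> SP_reach k Phi y T
| SP_reach_next (T T' : {set 'I_N}) :
    SP_reach k Phi y T -> SP_step k Phi y T T' ->
    norm2 (resid y (cols T' Phi)) <= norm2 (resid y (cols T Phi)) ->
    SP_reach k Phi y T'.

(* xhat is returned by an execution that quits: the candidate T' strictly
   increases the residual, and T is restored. *)
Definition SP_output (R : realType) (m N : nat) (k : nat) (Phi : 'M[R]_(m, N))
    (y : 'cV[R]_m) (xhat : 'cV[R]_N) : Prop :=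
  exists T T' : {set 'I_N},
    [/\ SP_reach k Phi y T,
        SP_step k Phi y T T',
        norm2 (resid y (cols T' Phi)) > norm2 (resid y (cols T Phi)),
        entries (~: T) xhat = 0 &
        entries T xhat = pinv (cols T Phi) *m y].

(* Main.v *)
Require Import Defs.
From mathcomp Require Import all_boot all_order all_algebra.
From mathcomp Require Import classical_sets reals.
From mathcomp Require Import fintype finset ring lra.

Set Implicit Arguments.
Unset Strict Implicit.
Unset Printing Implicit Defensive.

Import Order.TTheory GRing.Theory Num.Theory.
Local Open Scope ring_scope.

(** The proof replaces x by a 2K-sparse vector, absorbs the rest into the noise,
and shows that the pursuit cannot stop while its estimate is far from the
sparse vector.

Reduction. Let S1 carry the K largest entries of x, S2 the K largest entries of
the remainder x - xK, and X = S1 u S2. With x2 the restriction of x to X, one has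
y = Phi x2 + e' where e' = Phi (x - x2) + e. Cutting x - xK into blocks of K
entries of decreasing magnitude bounds both the Euclidean norm of x - x2 and,
up to a factor sqrt (1 + delta), that of its image by
norm1 (x - xK) / sqrt K ([norm2_tail_le]).

Stopping rule. Let k = 2K, let T be the current set, z the least-squares fit of
y on T, and w = x2 - z. All the vectors below live on T u S u X, a set of at
most 3k = 6K indices, where Phi nearly preserves inner products
([RIP_near_isometry]). This gives three facts:
- the indices S selected by correlation with the residual capture all of w but
  a part of norm at most 3/2 (delta |w| + sqrt (1 + delta) |e'|)
  ([selection_error]);
- the least-squares fit zp on T u S errs by little more than what it misses of
  x2 plus the noise ([least_squares_error]);
- keeping the k largest entries of zp at most doubles its error
  ([truncation_error]), and the new residual is no larger than the residual of
  this truncation ([least_squares_min]).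
Since the old residual is at least sqrt (1 - delta) |w| - |e'|, a strict increase
of the residual is incompatible with |e'| < delta |w| as soon as delta < 0.083
([quit_inequality]). Hence on quitting |x2 - xhat| <= |e'| / delta
([quit_error]). The constant c equals 1 / delta + (2 + delta) / (1 - delta), and
the second summand, which is at least 1, pays for |x - x2|. *)

(** * Euclidean geometry and vectors with restricted support *)

Section Euclidean.
Variable R : realType.

Definition dot n (u v : 'cV[R]_n) : R := (u^T *m v) 0 0.

Lemma dotE n (u v : 'cV[R]_n) : dot u v = \sum_i u i 0 * v i 0.
Proof. by rewrite /dot mxE; apply: eq_bigr => i _; rewrite mxE. Qed.

Lemma dotC n (u v : 'cV[R]_n) : dot u v = dot v u.
Proof. by rewrite !dotE; apply: eq_bigr => i _; rewrite mulrC. Qed.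

Lemma dotDl n (u v w : 'cV[R]_n) : dot (u + v) w = dot u w + dot v w.
Proof. by rewrite /dot linearD mulmxDl mxE. Qed.

Lemma dotZl n a (u v : 'cV[R]_n) : dot (a *: u) v = a * dot u v.
Proof. by rewrite /dot linearZ -scalemxAl mxE. Qed.

Lemma dotDr n (u v w : 'cV[R]_n) : dot w (u + v) = dot w u + dot w v.
Proof. by rewrite dotC dotDl !(dotC w). Qed.

Lemma dotZr n a (u v : 'cV[R]_n) : dot u (a *: v) = a * dot u v.
Proof. by rewrite dotC dotZl dotC. Qed.

Lemma dotNr n (u v : 'cV[R]_n) : dot u (- v) = - dot u v.
Proof. by rewrite -scaleN1r dotZr mulN1r. Qed.

Lemma dotNl n (u v : 'cV[R]_n) : dot (- u) v = - dot u v.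
Proof. by rewrite dotC dotNr dotC. Qed.

Lemma dot_mull m n (A : 'M[R]_(m, n)) u v : dot (A *m u) v = dot u (A^T *m v).
Proof. by rewrite /dot trmx_mul mulmxA. Qed.

Lemma dot_ge0 n (u : 'cV[R]_n) : 0 <= dot u u.
Proof. by rewrite dotE; apply: sumr_ge0 => i _; rewrite -expr2 sqr_ge0. Qed.

Lemma norm2_ge0 n (u : 'cV[R]_n) : 0 <= norm2 u.
Proof. exact: sqrtr_ge0. Qed.

Lemma norm2_sqr n (u : 'cV[R]_n) : norm2 u ^+ 2 = dot u u.
Proof.
rewrite /norm2 sqr_sqrtr; last by apply: sumr_ge0 => i _; exact: sqr_ge0.
by rewrite dotE; apply: eq_bigr => i _; rewrite expr2.
Qed.

Lemma ler_norm2 m n (u : 'cV[R]_m) (v : 'cV[R]_n) (c : R) : 0 <= c ->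
  dot u u <= c ^+ 2 * dot v v -> norm2 u <= c * norm2 v.
Proof.
move=> c0; rewrite -!norm2_sqr -exprMn ler_pXn2r ?nnegrE ?norm2_ge0 //.
by rewrite mulr_ge0 ?norm2_ge0.
Qed.

Lemma norm2_eq0 n (u : 'cV[R]_n) : norm2 u = 0 -> u = 0.
Proof.
move=> u0; have := norm2_sqr u; rewrite u0 expr0n /= dotE => /esym/eqP.
rewrite psumr_eq0; last by move=> i _; rewrite -expr2 sqr_ge0.
move=> /allP H; apply/colP => i; rewrite mxE.
by have := H i (mem_index_enum i); rewrite /= mulf_eq0 orbb => /eqP.
Qed.

Lemma norm20 n : norm2 (0 : 'cV[R]_n) = 0.
Proof.
by rewrite /norm2 big1 ?sqrtr0 // => i _; rewrite mxE expr0n.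
Qed.

Lemma norm2N n (u : 'cV[R]_n) : norm2 (- u) = norm2 u.
Proof.
by rewrite /norm2; congr Num.sqrt; apply: eq_bigr => i _; rewrite mxE sqrrN.
Qed.

Definition supported n (I : {set 'I_n}) (u : 'cV[R]_n) : Prop :=
  forall i, i \notin I -> u i 0 = 0.

Lemma supportedD n (I : {set 'I_n}) (u v : 'cV[R]_n) :
  supported I u -> supported I v -> supported I (u + v).
Proof. by move=> Hu Hv i iI; rewrite mxE Hu // Hv // addr0. Qed.

Lemma supportedZ n (I : {set 'I_n}) a u :
  supported I u -> supported I (a *: u).
Proof. by move=> Hu i iI; rewrite mxE Hu // mulr0. Qed.

Lemma supportedB n (I : {set 'I_n}) (u v : 'cV[R]_n) :
  supported I u -> supported I v -> supported I (u - v).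
Proof.
by move=> Hu Hv; apply: supportedD => //; rewrite -scaleN1r; apply: supportedZ.
Qed.

Lemma supportedW n (I J : {set 'I_n}) (u : 'cV[R]_n) :
  I \subset J -> supported I u -> supported J u.
Proof.
by move=> /subsetP IJ Hu i iJ; apply: Hu; apply: contra iJ; exact: IJ.
Qed.

(** Polarization, applied to |v| u and |u| v: these have equal norms, so the
parallelogram law for their sum and difference loses nothing. With M the
identity this is the Cauchy-Schwarz inequality; with M = 1 - Phi^T Phi it is the
near-preservation of inner products under the restricted isometry property. *)
Lemma quadratic_form_bound n (M : 'M[R]_n) (I : {set 'I_n}) (d : R) :
  M^T = M ->
  (forall u, supported I u -> `|dot u (M *m u)| <= d * dot u u) ->
  forall u v, supported I u -> supported I v ->
    dot u (M *m v) <= d * (norm2 u * norm2 v).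
Proof.
move=> symM HM u v Iu Iv.
have [u0|u0] := eqVneq (norm2 u) 0.
  by rewrite u0 (norm2_eq0 u0) mul0r mulr0 -(scale0r 0) dotZl mul0r.
have [v0|v0] := eqVneq (norm2 v) 0.
  by rewrite v0 (norm2_eq0 v0) !mulr0 mulmx0 -(scale0r 0) dotZr mul0r.
set a := norm2 u in u0 *; set b := norm2 v in v0 *.
have ab : 0 < a * b by rewrite mulr_gt0 // lt0r ?u0 ?v0 norm2_ge0.
have Cvu : dot v (M *m u) = dot u (M *m v) by rewrite dotC dot_mull symM.
have Ip : supported I (b *: u + a *: v) by apply: supportedD; exact: supportedZ.
have Im : supported I (b *: u - a *: v) by apply: supportedB; exact: supportedZ.
have := HM _ Ip; have := HM _ Im.
rewrite !(mulmxDr, mulmxN) -!scalemxAr.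
rewrite !(dotDl, dotDr, dotNl, dotNr, dotZl, dotZr) Cvu (dotC v u).
rewrite -!norm2_sqr -/a -/b !ler_norml => /andP[h1 _] /andP[_ h2].
rewrite -(ler_pM2l ab); lra.
Qed.

Lemma dot_le_norm2 n (u v : 'cV[R]_n) : dot u v <= norm2 u * norm2 v.
Proof.
rewrite -[norm2 u * _]mul1r -{1}(mul1mx v).
apply: (quadratic_form_bound (I := [set: 'I_n])) => [|w _|i|i].
- exact: trmx1.
- by rewrite mul1mx mul1r ger0_norm ?dot_ge0.
- by rewrite inE.
- by rewrite inE.
Qed.

Lemma ler_norm2D n (u v : 'cV[R]_n) : norm2 (u + v) <= norm2 u + norm2 v.
Proof.
rewrite -(@ler_pXn2r _ 2) ?nnegrE ?addr_ge0 ?norm2_ge0 //.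
rewrite sqrrD !norm2_sqr !(dotDl, dotDr) (dotC v u).
by have := dot_le_norm2 u v; lra.
Qed.

Lemma norm2_triangle n (w u v : 'cV[R]_n) :
  norm2 (u - v) <= norm2 (u - w) + norm2 (w - v).
Proof. by have := ler_norm2D (u - w) (w - v); rewrite addrA subrK. Qed.

Definition restr n (I : {set 'I_n}) (u : 'cV[R]_n) : 'cV[R]_n :=
  \col_i (if i \in I then u i 0 else 0).

Lemma restr_supported n (I : {set 'I_n}) (u : 'cV[R]_n) :
  supported I (restr I u).
Proof. by move=> i /negbTE iI; rewrite mxE iI. Qed.

Lemma restr_id n (I : {set 'I_n}) (u : 'cV[R]_n) :
  supported I u -> restr I u = u.
Proof.
by move=> Iu; apply/colP => i; rewrite mxE; case: ifPn => // /Iu ->.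
Qed.

Lemma restrC n (I : {set 'I_n}) (u : 'cV[R]_n) : restr I u + restr (~: I) u = u.
Proof.
by apply/colP => i; rewrite !mxE inE; case: ifP => _; rewrite ?addr0 ?add0r.
Qed.

Lemma dot_restrl n (I : {set 'I_n}) (u v : 'cV[R]_n) :
  dot (restr I u) v = \sum_(i in I) u i 0 * v i 0.
Proof.
rewrite dotE [RHS]big_mkcond; apply: eq_bigr => i _; rewrite mxE.
by case: ifP => // _; rewrite mul0r.
Qed.

Lemma dot_restr_restr n (I : {set 'I_n}) (u v : 'cV[R]_n) :
  dot (restr I u) (restr I v) = dot (restr I u) v.
Proof.
by rewrite !dot_restrl; apply: eq_bigr => i iI; rewrite mxE iI.
Qed.

Lemma norm2_restr_sqr n (I : {set 'I_n}) (u : 'cV[R]_n) :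
  norm2 (restr I u) ^+ 2 = \sum_(i in I) u i 0 ^+ 2.
Proof.
rewrite norm2_sqr dot_restr_restr dot_restrl.
by apply: eq_bigr => i _; rewrite expr2.
Qed.

Lemma norm2_restr_le n (I : {set 'I_n}) (u : 'cV[R]_n) :
  norm2 (restr I u) <= norm2 u.
Proof.
rewrite -(@ler_pXn2r _ 2) ?nnegrE ?norm2_ge0 //.
rewrite norm2_restr_sqr big_mkcond norm2_sqr dotE.
apply: ler_sum => i _; rewrite -expr2; case: ifP => // _; exact: sqr_ge0.
Qed.

Lemma dot_disjoint n (I : {set 'I_n}) (u v : 'cV[R]_n) :
  (forall i, i \in I -> v i 0 = 0) -> dot (restr I u) v = 0.
Proof. by move=> Iv; rewrite dot_restrl big1 // => i /Iv ->; rewrite mulr0. Qed.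

End Euclidean.

(** * Largest entries, and the tail of a vector *)

Section TopIndices.
Variable R : realType.

Lemma top_indices_exists n (z : 'cV[R]_n) k : (k <= n)%N ->
  exists S : {set 'I_n}, top_indices k z S.
Proof.
elim: k => [|k IH] kn.
  by exists set0; split; [rewrite cards0 | move=> i j; rewrite inE].
have [S [cS HS]] := IH (ltnW kn).
have /card_gt0P[i0 i0S] : (0 < #|~: S|)%N.
  by rewrite cardsCs setCK card_ord cS subn_gt0.
pose j := [arg max_(i > i0 in ~: S) `|z i 0|]%O.
have [jS jmax] : j \in ~: S /\ forall i, i \in ~: S -> `|z i 0| <= `|z j 0|.
  by rewrite /j; case: arg_maxP => // j' ? ?; split.
exists (j |: S); split; first by rewrite cardsU1 -in_setC jS cS.
move=> i l; rewrite !inE negb_or => iS /andP[_ lS].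
case/orP: iS => [/eqP->|iS]; last exact: HS.
by apply: jmax; rewrite inE.
Qed.

Lemma top_indices_bound n k (z : 'cV[R]_n) S j : top_indices k z S ->
  j \notin S -> k%:R * `|z j 0| <= \sum_(i in S) `|z i 0|.
Proof.
move=> [cS HS] jS; rewrite -cS mulr_natl -sumr_const.
by apply: ler_sum => i iS; exact: HS.
Qed.

(** X :\: S has at most as many indices as S :\: X, and each entry of z on the
former is dominated by each entry on the latter. *)
Lemma top_indices_sum n k (z : 'cV[R]_n) (S X : {set 'I_n}) :
  top_indices k z S -> (#|X| <= k)%N ->
  \sum_(i in X :\: S) z i 0 ^+ 2 <= \sum_(i in S :\: X) z i 0 ^+ 2.
Proof.
move=> [cS HS] cX.
have [E|/set0Pn[i0 i0X]] := eqVneq (X :\: S) set0.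
  by rewrite E big_set0; apply: sumr_ge0 => i _; exact: sqr_ge0.
pose j := [arg max_(i > i0 in X :\: S) `|z i 0|]%O.
have [jS jmax] :
    j \in X :\: S /\ forall i, i \in X :\: S -> `|z i 0| <= `|z j 0|.
  by rewrite /j; case: arg_maxP => // j' ? ?; split.
have cD : (#|X :\: S| <= #|S :\: X|)%N.
  by rewrite !cardsD setIC leq_sub2r // cS.
apply: (@le_trans _ _ (\sum_(i in X :\: S) `|z j 0| ^+ 2)).
  apply: ler_sum => i iX; rewrite -[_ ^+ 2]real_normK ?num_real //.
  by rewrite ler_pXn2r ?nnegrE // jmax.
rewrite sumr_const; apply: (@le_trans _ _ (`|z j 0| ^+ 2 *+ #|S :\: X|)).
  by rewrite -[leLHS]mulr_natr -[leRHS]mulr_natr ler_wpM2l ?exprn_ge0 ?ler_nat.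
rewrite -sumr_const; apply: ler_sum => i; rewrite inE => /andP[_ iS].
rewrite -[z i 0 ^+ 2]real_normK ?num_real // ler_pXn2r ?nnegrE //.
by apply: HS => //; move: jS; rewrite inE => /andP[].
Qed.

Lemma top_indices_norm2 n k (z : 'cV[R]_n) (S X : {set 'I_n}) :
  top_indices k z S -> (#|X| <= k)%N ->
  norm2 (restr (~: S) z) <= norm2 (restr (~: X) z).
Proof.
move=> topS cX; rewrite -(@ler_pXn2r _ 2) ?nnegrE ?norm2_ge0 //.
rewrite !norm2_restr_sqr (big_setID X) [leRHS](big_setID S) /=.
have -> : ~: S :&: X = X :\: S by rewrite setDE setIC.
have -> : ~: X :&: S = S :\: X by rewrite setDE setIC.
have -> : ~: S :\: X = ~: X :\: S by rewrite !setDE setIC.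
by rewrite lerD2r (top_indices_sum topS).
Qed.

Lemma norm2_le_max n (I : {set 'I_n}) (u : 'cV[R]_n) (c : R) : 0 <= c ->
  supported I u -> (forall i, `|u i 0| <= c) ->
  norm2 u <= Num.sqrt #|I|%:R * c.
Proof.
move=> c0 Iu uc.
rewrite -(@ler_pXn2r _ 2) ?nnegrE ?mulr_ge0 ?norm2_ge0 ?sqrtr_ge0 //.
rewrite exprMn -{1}(restr_id Iu) norm2_restr_sqr sqr_sqrtr //.
rewrite mulr_natl -sumr_const; apply: ler_sum => i _.
by rewrite -[_ ^+ 2]real_normK ?num_real // ler_pXn2r ?nnegrE.
Qed.

Lemma norm1_restrC n (I : {set 'I_n}) (u : 'cV[R]_n) :
  norm1 u = \sum_(i in I) `|u i 0| + norm1 (restr (~: I) u).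
Proof.
rewrite /norm1 (bigID (mem I)) /=; congr (_ + _); rewrite big_mkcond /=.
apply: eq_bigr => i _; rewrite mxE inE; case: ifP => // _; by rewrite normr0.
Qed.

(** Peel off blocks of K entries in decreasing order of magnitude: each entry of
a block is at most the mean magnitude of the preceding block, so the Euclidean
norm of a block is at most the l1 norm of the preceding block divided by
sqrt K. Summing over the blocks telescopes to the l1 norm of v. Each block
removes a nonzero entry, so the induction is on the number of nonzero
entries. *)
Lemma norm2_tail_le m n (A : 'M[R]_(m, n)) (K : nat) (s : R) :
  (0 < K)%N -> 0 <= s ->
  (forall (I : {set 'I_n}) u, (#|I| <= K)%N -> supported I u ->
    norm2 (A *m u) <= s * norm2 u) ->
  forall (v : 'cV[R]_n) S, top_indices K v S ->
    norm2 (A *m restr (~: S) v) <= s * (norm1 v / Num.sqrt K%:R).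
Proof.
move=> K0 s0 HA v.
have sK : 0 < Num.sqrt K%:R :> R by rewrite sqrtr_gt0 ltr0n.
have [p] := ubnP #|[set i | v i 0 != 0]|.
elim: p => // p IH in v *; rewrite ltnS => cv S topS.
set v' := restr (~: S) v.
have n1v : 0 <= norm1 v by apply: sumr_ge0.
have [v'0|/eqP v'n0] := eqVneq v' 0.
  by rewrite v'0 mulmx0 norm20 mulr_ge0 // divr_ge0 // ltW.
have /existsP[j jv] : [exists j, v' j 0 != 0].
  apply/contraT => /existsPn H; case: v'n0.
  by apply/colP => j; rewrite [RHS]mxE; apply/eqP/negPn/H.
have jS : j \notin S.
  by move: jv; rewrite mxE inE; case: (j \in S) => //=; rewrite eqxx.
have [i iS] : exists i, i \in S.
  by apply/card_gt0P; case: topS => ->.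
have vi : v i 0 != 0.
  have vj : v j 0 != 0 by move: jv; rewrite mxE inE jS.
  by rewrite -normr_gt0 (lt_le_trans _ (topS.2 _ _ iS jS)) // normr_gt0.
have cv' : (#|[set i | (v' i 0 != 0)%R]| < p)%N.
  apply: leq_trans cv; apply: proper_card; apply/properP; split.
    apply/subsetP => l; rewrite !inE mxE inE; by case: ifP; rewrite ?eqxx.
  by exists i; rewrite inE // mxE inE iS eqxx.
have kn : (K <= n)%N by rewrite -topS.1 -[leqRHS]card_ord max_card.
have [S' topS'] := top_indices_exists v' kn.
have IHv := IH v' cv' S' topS'.
rewrite -(restrC S' v') mulmxDr (le_trans (ler_norm2D _ _)) //.
rewrite (norm1_restrC S v) -/v' mulrDl mulrDr lerD //.
apply: le_trans (HA S' _ _ _) _; rewrite ?topS'.1 //.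
  exact: restr_supported.
rewrite ler_wpM2l //.
set a := \sum_(i in S) _.
have a0 : 0 <= a by apply: sumr_ge0.
apply: (@le_trans _ _ (Num.sqrt K%:R * (a / K%:R))).
  rewrite -[X in Num.sqrt X%:R]topS'.1; apply: norm2_le_max.
  - by rewrite divr_ge0.
  - exact: restr_supported.
  move=> l; rewrite !mxE !inE; case: (l \in S'); rewrite ?normr0 ?divr_ge0 //.
  case: ifPn; rewrite ?normr0 ?divr_ge0 // => lS.
  by rewrite ler_pdivlMr ?ltr0n // mulrC (top_indices_bound topS).
have KE : K%:R = Num.sqrt K%:R ^+ 2 :> R by rewrite sqr_sqrtr.
suff -> : Num.sqrt K%:R * (a / K%:R) = a / Num.sqrt K%:R by [].
by rewrite {2}KE; field; rewrite gt_eqF.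
Qed.

End TopIndices.

(** * Least squares on a set of columns *)

Section LeastSquares.
Variables (R : realType) (m N : nat) (Phi : 'M[R]_(m, N)).

(** The matrix of the inclusion of the coordinate subspace indexed by I; it turns
[cols] and [entries], whose dimensions depend on I, into matrix products. *)
Definition embed (I : {set 'I_N}) : 'M[R]_(N, #|I|) := cols I 1%:M.

Lemma colsE I : cols I Phi = Phi *m embed I.
Proof. by rewrite /embed /cols mulmx_colsub mulmx1. Qed.

Lemma entriesE I (z : 'cV[R]_N) : entries I z = (embed I)^T *m z.
Proof.
by rewrite /entries /embed /cols trmx_mxsub trmx1 mul_rowsub_mx mul1mx.
Qed.

Lemma embed_entries I (z : 'cV[R]_N) :
  supported I z -> embed I *m entries I z = z.
Proof.
move=> Iz; rewrite -[RHS](restr_id Iz); apply/colP => i; rewrite !mxE.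
under eq_bigr do rewrite !mxE.
rewrite -(big_enum_val (A := mem I) (fun l => (i == l)%:R * z l 0)) /=.
rewrite big_mkcond (bigD1 i) //= big1 ?addr0 => [|l li].
  by rewrite eqxx mul1r.
by rewrite eq_sym (negbTE li) mul0r; case: ifP.
Qed.

Lemma embed_supported I q : supported I (embed I *m q).
Proof.
move=> i iI; rewrite mxE big1 // => j _; rewrite !mxE.
have [ij|] := eqVneq i (enum_val j); last by rewrite mul0r.
by move: iI; rewrite ij enum_valP.
Qed.

Lemma entries_embed I q : entries I (embed I *m q) = q.
Proof.
rewrite entriesE mulmxA [X in X *m q](_ : _ = 1%:M) ?mul1mx //.
rewrite /embed /cols trmx_mxsub trmx1 mul_rowsub_mx mul1mx.
apply/matrixP => i j; rewrite !mxE.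
by rewrite (inj_eq enum_val_inj).
Qed.

Lemma entries_out I (z : 'cV[R]_N) : entries (~: I) z = 0 -> supported I z.
Proof.
move=> z0 i iI; have iC : i \in ~: I by rewrite inE.
move/colP/(_ (enum_rank_in iC i)): z0.
by rewrite !mxE enum_rankK_in.
Qed.

Lemma dot_embed I (u v : 'cV[R]_N) : supported I v ->
  dot (entries I u) (entries I v) = dot u v.
Proof. by move=> Iv; rewrite {1}entriesE dot_mull trmxK embed_entries. Qed.

Lemma RIP_supported k d (I : {set 'I_N}) (u : 'cV[R]_N) :
  RIP Phi k d -> (#|I| <= k)%N -> supported I u ->
  (1 - d) * dot u u <= dot (Phi *m u) (Phi *m u) <= (1 + d) * dot u u.
Proof.
move=> [_ _ /(_ I (entries I u))] H /H {}H Iu; move: H.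
by rewrite colsE -mulmxA embed_entries // !norm2_sqr dot_embed.
Qed.

Lemma gram_unit k d (I : {set 'I_N}) : RIP Phi k d -> d < 1 -> (#|I| <= k)%N ->
  (cols I Phi)^T *m cols I Phi \in unitmx.
Proof.
move=> rip d1 cI; rewrite unitmxE unitfE; apply/negP => /det0P[v v0 vA].
case/eqP: v0; apply: trmx_inj; rewrite trmx0; apply: norm2_eq0.
case: rip => _ _ /(_ I v^T cI)/andP[+ _].
rewrite [X in _ <= X]norm2_sqr dot_mull /dot trmxK !mulmxA.
rewrite -(mulmxA v) vA mul0mx mxE.
rewrite pmulr_rle0 ?subr_gt0 // => h; apply/eqP; rewrite -sqrf_eq0.
by rewrite eq_le h exprn_ge0 ?norm2_ge0.
Qed.

(** The normal equations: the residual is orthogonal to the columns in I. Here z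
is a vector of full length, so that fits on different sets can be compared. *)
Definition least_squares I (y : 'cV[R]_m) (z : 'cV[R]_N) : Prop :=
  supported I z /\ supported (~: I) (Phi^T *m (y - Phi *m z)).

Lemma pinv_least_squares k d (I : {set 'I_N}) y z :
  RIP Phi k d -> d < 1 -> (#|I| <= k)%N -> supported I z ->
  entries I z = pinv (cols I Phi) *m y ->
  least_squares I y z /\ resid y (cols I Phi) = y - Phi *m z.
Proof.
move=> rip d1 cI Iz zE.
have zp : cols I Phi *m (pinv (cols I Phi) *m y) = Phi *m z.
  by rewrite -zE colsE -mulmxA embed_entries.
split; last by rewrite /resid /proj zp.
split=> //; apply: entries_out; rewrite setCK entriesE mulmxA -trmx_mul -colsE.
by rewrite mulmxBr -zp /pinv !mulmxA mulmxV ?(gram_unit rip) // mul1mx subrr.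
Qed.

Lemma least_squares_exists k d (I : {set 'I_N}) y :
  RIP Phi k d -> d < 1 -> (#|I| <= k)%N ->
  exists z, [/\ least_squares I y z, entries I z = pinv (cols I Phi) *m y &
    resid y (cols I Phi) = y - Phi *m z].
Proof.
move=> rip d1 cI; exists (embed I *m (pinv (cols I Phi) *m y)).
have E := entries_embed (pinv (cols I Phi) *m y).
have [] := pinv_least_squares rip d1 cI _ E; first exact: embed_supported.
by split.
Qed.

(** Pythagoras: for u supported in I, the residual of z is orthogonal to
Phi (z - u). *)
Lemma least_squares_min (I : {set 'I_N}) y z u :
  least_squares I y z -> supported I u ->
  norm2 (y - Phi *m z) <= norm2 (y - Phi *m u).
Proof.
move=> [Iz zopt] Iu.
have -> : y - Phi *m u = y - Phi *m z + Phi *m (z - u).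
  by rewrite mulmxBr addrA subrK.
move: (y - Phi *m z) zopt => r zopt.
rewrite -(@ler_pXn2r _ 2) ?nnegrE ?norm2_ge0 // !norm2_sqr.
rewrite dotDl !dotDr (dotC r) dot_mull.
have -> : dot (z - u) (Phi^T *m r) = 0.
  rewrite -(restr_id (supportedB Iz Iu)) dot_disjoint // => i iI.
  by apply: zopt; rewrite inE negbK.
by have := dot_ge0 (Phi *m (z - u)); lra.
Qed.

(** * Consequences of the restricted isometry property *)

Lemma RIP_upper k d (I : {set 'I_N}) u :
  RIP Phi k d -> (#|I| <= k)%N -> supported I u ->
  norm2 (Phi *m u) <= Num.sqrt (1 + d) * norm2 u.
Proof.
move=> rip cI Iu; apply: ler_norm2; first exact: sqrtr_ge0.
have [_ /andP[d0 _] _] := rip.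
rewrite sqr_sqrtr; last by lra.
by have /andP[] := RIP_supported rip cI Iu.
Qed.

Lemma RIP_near_isometry k d (I : {set 'I_N}) u v :
  RIP Phi k d -> (#|I| <= k)%N -> supported I u -> supported I v ->
  dot u v <= dot (Phi *m u) (Phi *m v) + d * (norm2 u * norm2 v).
Proof.
move=> rip cI Iu Iv; rewrite -lerBlDl.
have -> : dot u v - dot (Phi *m u) (Phi *m v)
    = dot u ((1%:M - Phi^T *m Phi) *m v).
  by rewrite mulmxBl mul1mx dotDr dotNr dot_mull mulmxA.
apply: (quadratic_form_bound _ _ Iu Iv).
  by rewrite linearB /= trmx1 trmx_mul trmxK.
move=> w Iw; rewrite mulmxBl mul1mx dotDr dotNr -mulmxA -dot_mull ler_norml.
have /andP[] := RIP_supported rip cI Iw.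
by move=> h1 h2; apply/andP; split; lra.
Qed.

(** The way in which the normal equations and the selection rule are exploited:
information on the correlations Phi^T r of the residual r = Phi w + e, tested
against v, bounds the component of the error w along v. *)
Lemma correlation_bound k d (I : {set 'I_N}) v w e :
  RIP Phi k d -> (#|I| <= k)%N -> supported I v -> supported I w ->
  dot v w <= dot v (Phi^T *m (Phi *m w + e))
             + norm2 v * (d * norm2 w + Num.sqrt (1 + d) * norm2 e).
Proof.
move=> rip cI Iv Iw; rewrite -dot_mull dotDr.
have h1 := RIP_near_isometry rip cI Iv Iw.
have h2 := dot_le_norm2 (- (Phi *m v)) e; rewrite dotNl norm2N in h2.
have h3 := ler_wpM2r (norm2_ge0 e) (RIP_upper rip cI Iv).
lra.
Qed.

(** On I the correlations with the residual vanish, so testing against the error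
restricted to I bounds the latter by delta |x - z| + sqrt (1 + delta) |e|;
outside I the error is x itself. *)
Lemma least_squares_error k d (I J : {set 'I_N}) x z e :
  RIP Phi k d -> (#|J| <= k)%N -> I \subset J ->
  supported J x -> least_squares I (Phi *m x + e) z ->
  (1 - d) * norm2 (x - z)
    <= norm2 (restr (~: I) x) + Num.sqrt (1 + d) * norm2 e.
Proof.
move=> rip cJ IJ Jx [Iz zopt].
set w := x - z; set v := restr I w.
have Jw : supported J w by apply: supportedB => //; exact: supportedW Iz.
have Jv : supported J v by apply: supportedW IJ _; exact: restr_supported.
have rE : Phi *m x + e - Phi *m z = Phi *m w + e.
  by rewrite mulmxBr addrAC.
have h := correlation_bound e rip cJ Jv Jw.
have v0 : dot v (Phi^T *m (Phi *m w + e)) = 0.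
  rewrite dot_disjoint // => i iI; rewrite -rE; apply: zopt.
  by rewrite inE negbK.
have vw : dot v w = norm2 v ^+ 2 by rewrite norm2_sqr dot_restr_restr.
have wC : restr (~: I) w = restr (~: I) x.
  apply/colP => i; rewrite !mxE inE; case: ifPn => // iI.
  by rewrite Iz // subr0.
have wle : norm2 w <= norm2 v + norm2 (restr (~: I) x).
  by rewrite -wC -{1}(restrC I w) ler_norm2D.
have vle : norm2 v <= d * norm2 w + Num.sqrt (1 + d) * norm2 e.
  have [v00|v00] := eqVneq (norm2 v) 0.
    rewrite v00; have [_ /andP[d0 _] _] := rip.
    by rewrite addr_ge0 // mulr_ge0 ?norm2_ge0 ?sqrtr_ge0.
  have vp : 0 < norm2 v by rewrite lt0r v00 norm2_ge0.
  by rewrite -(ler_pM2l vp) -expr2 -vw; lra.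
lra.
Qed.

(** Let g be the vector of correlations, v the part of w missed by the selection
and h the restriction of g to S :\: X, where w vanishes. The selection rule makes
|g| on X :\: S at most |h|, hence dot v g <= |v| |h|, while dot h g = |h|^2. In
the test vector t = |h| v - |v| h these contributions to dot t g cancel, and
since v and h are orthogonal, |t| = sqrt 2 |v| |h|. Testing against v and h
separately would give the factor 2 in place of sqrt 2 <= 3/2, and with 2 the
inequalities chained in [quit_inequality] are compatible when delta is close to
0.083. *)
Lemma selection_error k d (J T X S : {set 'I_N}) w e :
  RIP Phi k d -> (#|J| <= k)%N -> (#|X| <= #|S|)%N ->
  T :|: S :|: X \subset J ->
  supported (T :|: X) w ->
  top_indices #|S| (Phi^T *m (Phi *m w + e)) S ->
  supported (~: T) (Phi^T *m (Phi *m w + e)) ->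
  norm2 (restr (~: (T :|: S)) w)
    <= 3 / 2 * (d * norm2 w + Num.sqrt (1 + d) * norm2 e).
Proof.
move=> rip cJ cX subJ TXw topS Tg.
set g := Phi^T *m _ in topS Tg *.
set v := restr _ w; set h := restr (S :\: X) g.
set a := norm2 v; set b := norm2 h.
set D := d * norm2 w + _.
have [_ /andP[d0 _] _] := rip.
have D0 : 0 <= D by rewrite addr_ge0 // mulr_ge0 ?norm2_ge0 ?sqrtr_ge0.
have a0 : 0 <= a := norm2_ge0 _.
have b0 : 0 <= b := norm2_ge0 _.
have Jw : supported J w.
  apply: (supportedW _ TXw); apply: fintype.subset_trans subJ.
  by apply/subsetP => i; rewrite !inE => /orP[]->; rewrite ?orbT.
have Jv : supported J v by move=> i iJ; rewrite mxE Jw // if_same.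
have Jh : supported J h.
  apply: (supportedW _ (restr_supported _)); apply: fintype.subset_trans subJ.
  by apply/subsetP => i; rewrite !inE => /andP[_ ->]; rewrite orbT.
have vXS : restr (X :\: S) v = v.
  apply: restr_id => i; rewrite !inE negb_and negbK mxE !inE negb_or.
  case/orP => [->|iX]; first by rewrite andbF.
  have [iT|iT] := boolP (i \in T) => //=.
  by rewrite TXw ?if_same // inE negb_or iT.
have vw : dot v w = a ^+ 2 by rewrite norm2_sqr dot_restr_restr.
have vh : dot v h = 0.
  rewrite dot_disjoint // => i; rewrite !inE negb_or mxE !inE.
  by case/andP=> _ /negbTE->; rewrite andbF.
have hw : dot h w = 0.
  rewrite dot_restrl big1 // => i; rewrite !inE => /andP[iX iS].
  have [iT|iT] := boolP (i \in T); first by rewrite Tg ?mul0r // inE negbK.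
  by rewrite TXw ?mulr0 // inE negb_or iT.
have hg : dot h g = b ^+ 2 by rewrite norm2_sqr dot_restr_restr.
have vg : dot v g <= a * b.
  rewrite -vXS -dot_restr_restr vXS.
  apply: le_trans (dot_le_norm2 _ _) _; rewrite ler_wpM2l //.
  rewrite -(@ler_pXn2r _ 2) ?nnegrE ?norm2_ge0 // !norm2_restr_sqr.
  exact: top_indices_sum topS cX.
have [az|an0] := eqVneq a 0; first by rewrite az; lra.
have ap : 0 < a by rewrite lt0r an0.
have [bz|bn0] := eqVneq b 0.
  have := correlation_bound e rip cJ Jv Jw.
  rewrite -/g -/D -/a vw => H; rewrite -(ler_pM2l ap).
  have := mulr_ge0 a0 D0; rewrite bz in vg; lra.
have bp : 0 < b by rewrite lt0r bn0.
pose t := b *: v - a *: h.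
have Jt : supported J t by apply: supportedB; apply: supportedZ.
have := correlation_bound e rip cJ Jt Jw; rewrite -/g -/D.
have tn : norm2 t <= 3 / 2 * (a * b).
  rewrite -(@ler_pXn2r _ 2) ?nnegrE ?norm2_ge0 //; last first.
    by have := mulr_ge0 a0 b0; lra.
  rewrite norm2_sqr /t !(dotDl, dotDr, dotNl, dotNr, dotZl, dotZr).
  rewrite (dotC h v) vh -!norm2_sqr -/a -/b.
  have := sqr_ge0 (a * b); lra.
have tD := ler_wpM2r D0 tn.
rewrite /t !(dotDl, dotNl, dotZl) hw hg vw -/t => H.
have bvg := ler_wpM2l b0 vg.
rewrite -(ler_pM2l ap) -(ler_pM2l bp); lra.
Qed.

End LeastSquares.

(** * One iteration of subspace pursuit *)

Section SubspacePursuit.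
Variables (R : realType) (m N : nat) (Phi : 'M[R]_(m, N)).

Lemma top_indices_entries k (I : {set 'I_N}) (z : 'cV[R]_N)
    (J : {set 'I_#|I|}) :
  supported I z -> top_indices k (entries I z) J ->
  top_indices k z [set enum_val j | j in J].
Proof.
move=> Iz [cJ HJ]; split; first by rewrite card_imset //; exact: enum_val_inj.
move=> _ l /imsetP[j jJ ->] lJ.
have [lI|/Iz->] := boolP (l \in I); last by rewrite normr0.
have := HJ j (enum_rank_in lI l) jJ; rewrite !mxE enum_rankK_in //; apply.
apply: contra lJ => lJ; apply/imsetP; exists (enum_rank_in lI l) => //.
by rewrite enum_rankK_in.
Qed.

(** Restricting z to S is at least as close to z as restricting it to X, and the
latter differs from z by at most |x - z|, because x vanishes outside X. *)
Lemma truncation_error k (x z : 'cV[R]_N) (S X : {set 'I_N}) :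
  top_indices k z S -> (#|X| <= k)%N -> supported X x ->
  norm2 (x - restr S z) <= 2 * norm2 (x - z).
Proof.
move=> topS cX Xx.
have h1 := norm2_triangle z x (restr S z).
have h2 := top_indices_norm2 topS cX.
have h3 := norm2_restr_le (~: X) (z - x).
have E1 : z - restr S z = restr (~: S) z.
  by rewrite -{1}(restrC S z) addrC addKr.
have E2 : restr (~: X) (z - x) = restr (~: X) z.
  apply/colP => i; rewrite !mxE inE; case: ifPn => // iX.
  by rewrite Xx // subr0.
have E3 : norm2 (z - x) = norm2 (x - z) by rewrite -norm2N opprB.
rewrite E2 E3 in h3; rewrite E1 in h1; lra.
Qed.

Lemma SP_reach_card k y T : SP_reach k Phi y T -> #|T| = k.
Proof.
case=> [{}T [] //|T0 {}T _ [S _ [J [cJ _] ->]] _].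
by rewrite card_imset //; exact: enum_val_inj.
Qed.

(** The arithmetic behind the threshold 0.083. If E < d W, the hypotheses chain to
P <= 0.372 W, so r' <= 0.858 W, whereas r >= 0.95 W - E >= 0.867 W. *)
Lemma quit_inequality (d s t W P E V r r' : R) :
  0 < d -> d < 83%:R / 1000%:R -> 0 <= s -> s ^+ 2 = 1 + d ->
  0 <= t -> t ^+ 2 = 1 - d -> 0 <= W -> 0 <= P -> 0 <= E ->
  V <= 3 / 2 * (d * W + s * E) ->
  (1 - d) * P <= V + s * E ->
  t * W - E <= r -> r < r' -> r' <= s * (2 * P) + E ->
  d * W <= E.
Proof.
move=> d0 d83 s0 s2 t0 t2 W0 P0 E0 HV HP Hr rr' Hr'.
rewrite leNgt; apply/negP => EW.
have sle : s <= 1041%:R / 1000%:R.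
  rewrite -(@ler_pXn2r _ 2) ?nnegrE ?s2 //; lra.
have tge : 95%:R / 100%:R <= t.
  rewrite -(@ler_pXn2r _ 2) ?nnegrE ?t2 //; lra.
have dW : d * W <= 83%:R / 1000%:R * W by rewrite ler_wpM2r // ltW.
have dP : d * P <= 83%:R / 1000%:R * P by rewrite ler_wpM2r // ltW.
have sE : s * E <= 1041%:R / 1000%:R * E by rewrite ler_wpM2r.
have sP : s * P <= 1041%:R / 1000%:R * P by rewrite ler_wpM2r.
have tW : 95%:R / 100%:R * W <= t * W by rewrite ler_wpM2r.
lra.
Qed.

(** For T the current set and T' a candidate with a larger residual, the fit on T
is already within |e| / d of every k-sparse vector that explains y up to e. *)
Lemma quit_error k d (X T T' : {set 'I_N}) (x z : 'cV[R]_N) (e : 'cV[R]_m) :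
  let y := Phi *m x + e in
  RIP Phi (3 * k) d -> 0 < d -> d < 83%:R / 1000%:R ->
  (#|X| <= k)%N -> supported X x -> #|T| = k ->
  supported T z -> entries T z = pinv (cols T Phi) *m y ->
  SP_step k Phi y T T' ->
  norm2 (resid y (cols T Phi)) < norm2 (resid y (cols T' Phi)) ->
  d * norm2 (x - z) <= norm2 e.
Proof.
move=> y rip d0 d83 cX Xx cT Tz zE [S topS [J topJ T'E]].
have d1 : d < 1 by lra.
have cS : #|S| = k by case: topS.
have cT3 : (#|T| <= 3 * k)%N by rewrite cT leq_pmull.
have [zls rT] := pinv_least_squares rip d1 cT3 Tz zE.
have cTS : (#|T :|: S| <= 2 * k)%N.
  by rewrite mul2n -addnn -{1}cT -cS leq_card_setU.
have cTS3 : (#|T :|: S| <= 3 * k)%N.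
  by rewrite (leq_trans cTS) // leq_mul2r orbT.
have [zp [zpls zpE _]] := least_squares_exists y rip d1 cTS3.
rewrite -zpE in topJ; have := top_indices_entries zpls.1 topJ.
rewrite -T'E => topT'.
have cT'3 : (#|T'| <= 3 * k)%N by rewrite topT'.1 leq_pmull.
have [z' [z'ls _ rT']] := least_squares_exists y rip d1 cT'3.
rewrite rT rT' => rr'; rewrite rT in topS.
pose I := T :|: S :|: X.
have cI : (#|I| <= 3 * k)%N.
  apply: leq_trans (leq_card_setU _ _) _.
  by rewrite (mulSn 2) addnC leq_add.
have XI : X \subset I by rewrite subsetUr.
have TSI : T :|: S \subset I by rewrite subsetUl.
have TI : T \subset I by apply: fintype.subset_trans TSI; rewrite subsetUl.
set w := x - z.
have yz u : y - Phi *m u = Phi *m (x - u) + e by rewrite mulmxBr addrAC.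
have Iw : supported I w.
  by apply: supportedB; [exact: supportedW XI Xx | exact: supportedW TI Tz].
have Ix : supported I x := supportedW XI Xx.
pose u := restr T' zp.
have Iu : supported I u.
  move=> i iI; rewrite mxE; case: ifP => // _; apply: zpls.1.
  by apply: contra iI; apply/subsetP.
have HV := @selection_error R m N Phi (3 * k) d I T X S w e rip cI.
rewrite cS -yz in HV; have {}HV := HV cX (subxx _).
have TXw : supported (T :|: X) w.
  apply: supportedB; first exact: supportedW (subsetUr _ _) Xx.
  exact: supportedW (subsetUl _ _) Tz.
have {}HV := HV TXw topS zls.2.
have HP := least_squares_error rip cI TSI Ix zpls.
have wx : restr (~: (T :|: S)) w = restr (~: (T :|: S)) x.
  apply/colP => i; rewrite !mxE !inE; case: ifPn => //.
  by rewrite negb_or => /andP[iT _]; rewrite Tz // subr0.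
rewrite wx in HV.
have [_ /andP[_ dle1] _] := rip.
apply: (@quit_inequality d (Num.sqrt (1 + d)) (Num.sqrt (1 - d)) _ _ _ _ _ _
  d0 d83 _ _ _ _ _ _ _ HV HP _ rr');
  rewrite ?sqrtr_ge0 ?norm2_ge0 ?sqr_sqrtr //; try lra.
- have h : Num.sqrt (1 - d) * norm2 w <= norm2 (Phi *m w).
    rewrite -(@ler_pXn2r _ 2) ?nnegrE ?mulr_ge0 ?sqrtr_ge0 ?norm2_ge0 //.
    rewrite exprMn sqr_sqrtr ?subr_ge0 // !norm2_sqr.
    by have /andP[] := RIP_supported rip cI Iw.
  have := ler_norm2D (y - Phi *m z) (- e); rewrite norm2N {1}yz addrK; lra.
- apply: le_trans (least_squares_min z'ls (restr_supported _)) _.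
  rewrite -/u yz (le_trans (ler_norm2D _ _)) // lerD2r.
  apply: le_trans (RIP_upper rip cI (supportedB Ix Iu)) _.
  by rewrite ler_wpM2l ?sqrtr_ge0 // (truncation_error topT' cX Xx).
Qed.

End SubspacePursuit.

Theorem corollary1 (R : realType) (m N K : nat) (Phi : 'M[R]_(m, N))
    (x xK xhat : 'cV[R]_N) (e y : 'cV[R]_m) :
  let delta := RIP_const Phi (6 * K) in
  let c := (1 + delta + delta ^+ 2) / (delta * (1 - delta)) in
  (0 < K)%N ->
  best_approx K x xK ->
  x - xK != 0 ->
  y = Phi *m x + e ->
  RIP Phi (6 * K) delta ->
  0 < delta ->
  delta < 83%:R / 1000%:R ->
  SP_output (2 * K) Phi y xhat ->
  norm2 (x - xhat)
    <= c * (norm2 e + Num.sqrt ((1 + delta) / K%:R) * norm1 (x - xK)).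
Proof.
move=> delta c K0 [S1 topS1 xKE] _ yE rip d0 d83.
move=> [T [T' [reachT stepT rr' xhat0 xhatE]]].
have [_ /andP[_ d1] _] := rip.
have KN : (K <= N)%N by rewrite -topS1.1 -[leqRHS]card_ord max_card.
set v := x - xK.
have vE : v = restr (~: S1) x.
  by rewrite /v xKE -/(restr S1 x) -{1}(restrC S1 x) addrC addKr.
have [S2 topS2] := top_indices_exists v KN.
pose X := S1 :|: S2; pose x2 := restr X x.
have tailE : x - x2 = restr (~: S2) v.
  apply/colP => i; rewrite vE !mxE !inE.
  by case: (i \in S1); case: (i \in S2); rewrite /= ?subrr ?subr0.
have cX : (#|X| <= 2 * K)%N.
  by rewrite mul2n -addnn -{1}topS1.1 -topS2.1 leq_card_setU.
pose L := norm1 v / Num.sqrt K%:R.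
have tail2 : norm2 (x - x2) <= L.
  rewrite tailE -[leRHS]mul1r -[restr _ _]mul1mx.
  apply: (norm2_tail_le (A := 1%:M)) topS2 => // I u _ _.
  by rewrite mul1mx mul1r.
have tailPhi : norm2 (Phi *m (x - x2)) <= Num.sqrt (1 + delta) * L.
  rewrite tailE; apply: norm2_tail_le topS2 => //; first exact: sqrtr_ge0.
  move=> I u cI; apply: RIP_upper rip _.
  by rewrite (leq_trans cI) // leq_pmull.
pose e' := Phi *m (x - x2) + e.
have yE' : y = Phi *m x2 + e' by rewrite yE /e' addrA -mulmxDr (addrC x2) subrK.
have rip3 : RIP Phi (3 * (2 * K)) delta by rewrite mulnA.
have := quit_error (e := e') rip3 d0 d83 cX (@restr_supported _ _ X x)
  (SP_reach_card reachT) (entries_out xhat0).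
rewrite -/x2 -yE' => /(_ T' xhatE stepT rr') H.
have e'le : norm2 e' <= norm2 e + Num.sqrt (1 + delta) * L.
  by rewrite addrC (le_trans (ler_norm2D _ _)) // lerD2r.
have -> : Num.sqrt ((1 + delta) / K%:R) * norm1 v = Num.sqrt (1 + delta) * L.
  rewrite sqrtrM ?sqrtrV ?ler0n //; last by lra.
  by rewrite /L -mulrA (mulrC _ (norm1 v)).
have s1 : 1 <= Num.sqrt (1 + delta).
  by rewrite -{1}(sqrtr1 R); apply: ler_wsqrtr; lra.
set Q := norm2 e + _ in e'le *.
have L0 : 0 <= L by apply: le_trans tail2; exact: norm2_ge0.
have LQ : L <= Q.
  have := norm2_ge0 e; have := ler_wpM2r L0 s1; rewrite /Q; lra.
have Q0 : 0 <= Q := le_trans L0 LQ.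
(* The first summand pays for |x2 - xhat|, the second for |x - x2|. *)
have cE : c = delta^-1 + (2 + delta) / (1 - delta).
  by rewrite /c; field; apply/andP; split; rewrite ?gt_eqF //; lra.
have h1 : norm2 (x2 - xhat) <= delta^-1 * Q.
  by rewrite ler_pdivlMl // (le_trans H).
have h2 : 1 <= (2 + delta) / (1 - delta) by rewrite ler_pdivlMr; lra.
rewrite cE mulrDl; have := norm2_triangle x2 x xhat.
have := ler_wpM2r Q0 h2; lra.
Qed.
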